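(* For every real $p>2$ and every integer $n\ge 1$, $$A_{p,n}=A_{p,n}(\mathrm{Haar}).$$
   Context: All random variables are real-valued. Let $(X,\mathscr F,\mu)$ be a probability space. A discrete filtration is an increasing sequence of $\sigma$-algebras $\mathscr F_0\subset\mathscr F_1\subset\dots\subset\mathscr F$ such that each $\mathscr F_k$ is generated by a finite or countable partition $\mathscr D_k$ of $X$ into disjoint measurable sets of positive measure, where $\mathscr D_0=\{X\}$ and every set in $\mathscr D_k$ is a union of elements of $\mathscr D_{k+1}$. A (discrete) martingale-difference sequence $d=\{d_1,\dots,d_n\}$ with respect to such a filtration is a sequence of integrable random variables with $d_k$ being $\mathscr F_k$-measurable and $\int_V d_k\,d\mu=0$ for every $V\in\mathscr D_{k-1}$, $k=1,\dots,n$. Its square function is $$\mathfrak S(d)(x)=\Big(\sum_{k=1}^n |D_k(x)|^2\Big)^{1/2},\qquad D_k(x)=\sum_{V\in\mathscr D_{k-1}}\|\mathbf 1_V d_k\|_\infty\,\mathbf 1_V(x).$$ It depends on the partitions as well as on the $d_k$. Define $$A_{p,n}=\sup_{d}\frac{\left\|\sum_{k=1}^n d_k\right\|_p}{\|\mathfrak S(d)\|_\infty},$$ the supremum being over all probability spaces, all discrete filtrations and all non-trivial martingale-difference sequences $d=\{d_1,\dots,d_n\}$ with exactly $n$ elements (non-trivial and such that the ratio makes sense: $0<\|\mathfrak S(d)\|_\infty<\infty$). $A_{p,n}(\mathrm{Haar})$ is the same supremum restricted to Haar martingales: $X=[0,1)$ with Lebesgue measure, $\mathscr D_k$ is the family of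 the $2^k$ dyadic intervals $[(j-1)/2^k,j/2^k)$, $1\le j\le 2^k$, and $d_k=\sum_{j=2^{k-1}+1}^{2^k}a_jh_j$ with real coefficients $a_j$, where, for $m=2^k+j$, $k\ge 0$, $1\le j\le 2^k$, the Haar function is $h_m=\mathbf 1_{[\frac{j-1}{2^k},\frac{2j-1}{2^{k+1}})}-\mathbf 1_{[\frac{2j-1}{2^{k+1}},\frac{j}{2^k})}$. (In this case $D_k=|d_k|$.) *)

(* Defs.v *)
From HB Require Import structures.
From mathcomp Require Import all_boot all_order all_algebra.
From mathcomp Require Import all_classical all_reals all_analysis.

Set Implicit Arguments.
Unset Strict Implicit.
Unset Printing Implicit Defensive.

Import Order.TTheory GRing.Theory Num.Theory.

Local Open Scope classical_set_scope.
Local Open Scope ring_scope.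
Local Open Scope ereal_scope.

Section martingale_differences.
Context (R : realType) (d : measure_display) (X : measurableType d).
Variable P : probability X R.

Definition discrete_filtration (D : nat -> set (set X)) : Prop :=
  [/\ D 0%N = [set setT],
      forall k, countable (D k),
      forall k, partition (D k) id setT,
      forall k V, D k V -> measurable V /\ 0 < P V &
      forall k V, D k V ->
        exists2 E, E `<=` D k.+1 & V = \bigcup_(W in E) W].

(* Only the terms f 1, ..., f n of the sequence f are relevant; the n-th
   sigma-algebra of the filtration is the one generated by D n. *)
Definition martingale_difference (D : nat -> set (set X)) (n : nat)
    (f : nat -> X -> R) : Prop :=
  forall k, (1 <= k <= n)%N ->
    [/\ P.-integrable setT (EFin \o f k),
        measurable_fun [set: g_sigma_algebraType (D k)]
          (f k : g_sigma_algebraType (D k) -> R) &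
        forall V, D k.-1 V -> \int[P]_(x in V) (f k x)%:E = 0].

(* Extended-real valued, as f k is only assumed integrable. *)
Definition local_sup (D : nat -> set (set X)) (f : nat -> X -> R)
    (k : nat) (x : X) : \bar R :=
  \esum_(V in D k.-1)
    ('N[P]_+oo[(fun y => (\1_V y * f k y)%:E)] * (\1_V x)%:E).

Definition square_function (D : nat -> set (set X)) (n : nat)
    (f : nat -> X -> R) (x : X) : \bar R :=
  (\sum_(1 <= k < n.+1) local_sup D f k x ^+ 2) `^ 2^-1.

Definition nontrivial_square_function (D : nat -> set (set X)) (n : nat)
    (f : nat -> X -> R) : Prop :=
  0 < 'N[P]_+oo[square_function D n f] < +oo.

Definition norm_ratio (p : R) (D : nat -> set (set X)) (n : nat)
    (f : nat -> X -> R) : \bar R :=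
  'N[P]_p%:E[(fun x => (\sum_(1 <= k < n.+1) f k x)%:E)]
    / 'N[P]_+oo[square_function D n f].

End martingale_differences.

Definition A_const (R : realType) (p : R) (n : nat) : \bar R :=
  ereal_sup [set r | exists (d : measure_display) (X : measurableType d)
      (P : probability X R) (D : nat -> set (set X)) (f : nat -> X -> R),
    [/\ discrete_filtration P D, martingale_difference P D n f,
        nontrivial_square_function P D n f & r = norm_ratio P p D n f]].

Section unit_interval.
Variable R : realType.

Definition Ico01 : Type := {x : R | (0 <= x < 1)%R}.

HB.instance Definition _ := Choice.on Ico01.

Lemma zero_in_Ico01 : (0 <= (0 : R) < 1)%R.
Proof. by rewrite lexx ltr01. Qed.

HB.instance Definition _ := isPointed.Build Ico01 (exist _ 0%R zero_in_Ico01).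

Definition Ico01_val (x : Ico01) : R := sval x.

(* [0, 1) with its Borel sigma-algebra. *)
Definition borel01 := g_sigma_algebra_preimageType Ico01_val.

HB.instance Definition _ := Measurable.on borel01.

Definition lebesgue01 (A : set borel01) : \bar R :=
  lebesgue_measure (Ico01_val @` A).

Lemma Ico01_val_inj : injective Ico01_val.
Proof. exact: val_inj. Qed.

Lemma image_Ico01_val_preimage (B : set R) :
  Ico01_val @` (Ico01_val @^-1` B) = B `&` `[0%R, 1%R[.
Proof.
apply/seteqP; split => [_ [x Bx <-]|x [Bx]].
  by split=> //=; rewrite in_itv; exact: (svalP x).
by rewrite /= in_itv /= => x01; exists (exist _ x x01).
Qed.

Lemma measurable_image_Ico01_val (A : set borel01) :
  measurable A -> measurable (Ico01_val @` A).
Proof.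
move=> -[B mB <-]; rewrite setTI image_Ico01_val_preimage.
by apply: measurableI.
Qed.

Let lebesgue01_0 : lebesgue01 set0 = 0.
Proof. by rewrite /lebesgue01 image_set0 measure0. Qed.

Let lebesgue01_ge0 A : 0 <= lebesgue01 A.
Proof. exact: measure_ge0. Qed.

Let lebesgue01_sigma_additive : semi_sigma_additive lebesgue01.
Proof.
move=> F mF tF mUF; rewrite /lebesgue01 image_bigcup.
apply: measure_semi_sigma_additive.
- by move=> i; apply: measurable_image_Ico01_val.
- apply/trivIsetP => i j _ _ ij; rewrite -subset0 => _ [[x Fx <-] [y Fy]].
  move=> /Ico01_val_inj xy; rewrite xy in Fy.
  move/trivIsetP : tF => /(_ i j I I ij); rewrite -subset0 => /(_ x); exact.
- by rewrite -image_bigcup; exact: measurable_image_Ico01_val.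
Qed.

HB.instance Definition _ := isMeasure.Build _ _ _ lebesgue01
  lebesgue01_0 lebesgue01_ge0 lebesgue01_sigma_additive.

Let lebesgue01_setT : lebesgue01 setT = 1.
Proof.
rewrite /lebesgue01 -(preimage_setT Ico01_val) image_Ico01_val_preimage setTI.
by rewrite lebesgue_measure_itv /= lte_fin ltr01 oppr0 adde0.
Qed.

HB.instance Definition _ :=
  Measure_isProbability.Build _ _ _ lebesgue01 lebesgue01_setT.

End unit_interval.

Section haar.
Variable R : realType.

Definition dyadic_partition (k : nat) : set (set (borel01 R)) :=
  [set V | exists2 j, (1 <= j <= 2 ^ k)%N &
     V = [set x | (j%:R - 1) / 2 ^+ k <= Ico01_val x < j%:R / 2 ^+ k]%R].

(* For m >= 2, m = 2 ^ k + j with 1 <= j <= 2 ^ k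
   iff k = trunc_log 2 (m - 1) and j = m - 2 ^ k. *)
Definition haar (m : nat) (x : R) : R :=
  let k := trunc_log 2 m.-1 in
  let j := ((m - 2 ^ k)%N%:R : R)%R in
  (\1_(`[((j - 1) / 2 ^+ k), ((2 * j - 1) / 2 ^+ k.+1)[) x
   - \1_(`[((2 * j - 1) / 2 ^+ k.+1), (j / 2 ^+ k)[) x)%R.

Definition haar_martingale (a : nat -> R) (k : nat) (x : borel01 R) : R :=
  (\sum_((2 ^ k.-1).+1 <= j < (2 ^ k).+1) a j * haar j (Ico01_val x))%R.

End haar.

Definition A_const_haar (R : realType) (p : R) (n : nat) : \bar R :=
  ereal_sup [set r | exists a : nat -> R,
    let P : probability (borel01 R) R := @lebesgue01 R in
    let D := @dyadic_partition R in
    let f := haar_martingale a in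
    nontrivial_square_function P D n f /\ r = norm_ratio P p D n f].

(* Main.v *)
(* A martingale difference d_1, ..., d_n whose square function is bounded by s
   is compared with the Bellman function of Haar martingales,
     B_m(x, L) = sup E |x + h_1 + ... + h_m|^p,
   the supremum being over the Haar martingales whose square function is at
   most the square root of L.  As a supremum of averages of translates of
   |x|^p, B_m is convex in x, and running a fair step +-t before two optimal strategies gives
     B_m(x + t, L - t^2) + B_m(x - t, L - t^2) <= 2 B_(m+1)(x, L).
   Hence, if |d| <= t, then B_m(x + d, L - t^2) lies below an affine function
   of d with value at most B_(m+1)(x, L) at d = 0, so that
     E B_(n-k)(d_1 + ... + d_k, s^2 - D_1^2 - ... - D_k^2)
   does not increase with k; here D_k is predictable and |d_k| <= D_k.
   At k = n this is E |d_1 + ... + d_n|^p, and at k = 0 it is B_n(0, s^2). *)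

Require Import Defs.
From mathcomp Require Import all_boot all_order all_algebra.
From mathcomp Require Import all_classical all_reals all_analysis.
From mathcomp Require Import ess_sup_inf measurable_realfun.
From mathcomp Require Import ring lra zify.
Import Order.TTheory GRing.Theory Num.Theory.
Local Open Scope ring_scope.

Set Implicit Arguments.
Unset Strict Implicit.
Unset Printing Implicit Defensive.

(** * Strategies for dyadic martingales and their Bellman function *)

Section strategies.
Local Open Scope classical_set_scope.
Context (R : realType).
Variable p : R.
Implicit Types (c : seq bool -> R) (x y L M t d : R) (n : nat).

(* A strategy c prescribes the coefficient c s after the outcomes s of the
   previous steps, where false stands for + and true for -. *)
Definition branch c (b : bool) : seq bool -> R := fun s => c (b :: s).

(** The mean of [|x + h_1 + ... + h_n|^p] over the [2 ^ n] equally likely outcomes of [c]. *)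
Fixpoint value n c x : R :=
  if n is n'.+1 then
    (value n' (branch c false) (x + c [::])
     + value n' (branch c true) (x - c [::])) / 2
  else `|x| `^ p.

(** The squared sup norm of the square function: the largest sum of squared coefficients along a
    path. *)
Fixpoint cost n c : R :=
  if n is n'.+1 then
    c [::] ^+ 2 + Num.max (cost n' (branch c false)) (cost n' (branch c true))
  else 0.

Lemma value_ge0 n c x : 0 <= value n c x.
Proof.
elim: n c x => [|n IH] c x /=; first exact: powR_ge0.
by rewrite divr_ge0// addr_ge0.
Qed.

Lemma cost_ge0 n c : 0 <= cost n c.
Proof.
by elim: n c => [|n IH] c //=; rewrite addr_ge0 ?sqr_ge0// le_max IH.
Qed.

Lemma cost0 n : cost n (fun=> 0) = 0.
Proof.
by elim: n => //= n IH; rewrite /branch IH maxxx expr0n addr0.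
Qed.

Lemma value_convex n c (w x y : R) : 1 <= p -> 0 <= w <= 1 ->
  value n c (w * x + (1 - w) * y) <= w * value n c x + (1 - w) * value n c y.
Proof.
move=> p1 /andP[w0 w1]; elim: n c x y => [|n IH] c x y /=.
  have v0 : 0 <= 1 - w by rewrite subr_ge0.
  apply: (@le_trans _ _ ((w * `|x| + (1 - w) * `|y|) `^ p)).
    apply: ge0_ler_powR; rewrite ?nnegrE ?addr_ge0 ?mulr_ge0// ?(le_trans _ p1)//.
    by rewrite (le_trans (ler_normD _ _))// !normrM (ger0_norm w0) (ger0_norm v0).
  pose i := Itv01 w0 w1.
  have := @convex_powR R p p1 i `|x| `|y|.
  by rewrite !convRE /=; apply; rewrite inE /= in_itv/= andbT.
have := IH (branch c false) (x + c [::]) (y + c [::]).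
have := IH (branch c true) (x - c [::]) (y - c [::]).
have -> : w * (x - c [::]) + (1 - w) * (y - c [::]) = w * x + (1 - w) * y - c [::] by ring.
have -> : w * (x + c [::]) + (1 - w) * (y + c [::]) = w * x + (1 - w) * y + c [::] by ring.
lra.
Qed.

(** A crude bound, uniform in [c]: every coefficient met is at most [M] in absolute value. It makes
    the set in [bell] bounded, so that its [sup] is a genuine supremum. *)
Lemma value_le n c x M : 0 <= p -> 0 <= M -> cost n c <= M ^+ 2 ->
  value n c x <= (`|x| + n%:R * M) `^ p.
Proof.
move=> p0 M0; elim: n c x => [|n IH] c x /=; first by rewrite mul0r addr0.
move=> cM.
have n0 : 0 <= n%:R * M by rewrite mulr_ge0.
have c0 : `|c [::]| <= M.
  rewrite -(ler_pXn2r (_ : 0 < 2)%N) ?nnegrE// real_normK ?num_real//.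
  by apply: le_trans cM; rewrite lerDl le_max cost_ge0.
have H b y : `|y| <= `|x| + M ->
    value n (branch c b) y <= (`|x| + n.+1%:R * M) `^ p.
  move=> yx; apply: (le_trans (IH _ _ _)).
    apply: le_trans cM; rewrite -[leLHS]add0r lerD ?sqr_ge0// le_max.
    by case: b; rewrite lexx ?orbT.
  apply: ge0_ler_powR; rewrite ?nnegrE ?addr_ge0 ?mulr_ge0//.
  by rewrite -natr1 mulrDl mul1r; lra.
have h1 := H false (x + c [::]); have h2 := H true (x - c [::]).
have := ler_normD x (c [::]); have := ler_normB x (c [::]).
lra.
Qed.

(* The Bellman function of the problem restricted to dyadic martingales. *)
Definition bell n x L : R := sup [set value n c x | c in [set c | cost n c <= L]].

Hypothesis p1 : 1 <= p.

Let p0 : 0 <= p. Proof. exact: le_trans p1. Qed.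

Lemma value_le_bell n c x L : 0 <= L -> cost n c <= L -> value n c x <= bell n x L.
Proof.
move=> L0 cL; apply: ub_le_sup; last by exists c.
exists ((`|x| + n%:R * Num.sqrt L) `^ p) => _ [c' /= c'L <-].
by apply: value_le; rewrite ?sqrtr_ge0// sqr_sqrtr.
Qed.

Lemma bell_le n x L M : 0 <= L ->
  (forall c, cost n c <= L -> value n c x <= M) -> bell n x L <= M.
Proof.
move=> L0 H; apply: ge_sup; first by exists (value n (fun=> 0) x), (fun=> 0); rewrite //= cost0.
by move=> _ [c /= cL <-]; exact: H.
Qed.

Lemma bell_ge0 n x L : 0 <= L -> 0 <= bell n x L.
Proof.
move=> L0; apply: (le_trans (value_ge0 n (fun=> 0) x)).
by apply: value_le_bell; rewrite ?cost0.
Qed.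

Lemma bell0 x L : 0 <= L -> bell 0 x L = `|x| `^ p.
Proof.
move=> L0; apply/eqP; rewrite eq_le bell_le//=.
by rewrite (@value_le_bell 0 (fun=> 0)).
Qed.

Lemma bell_convex n (w x y : R) L : 0 <= L -> 0 <= w <= 1 ->
  bell n (w * x + (1 - w) * y) L <= w * bell n x L + (1 - w) * bell n y L.
Proof.
move=> L0 w01; apply: bell_le => // c cL; apply: (le_trans (value_convex _ _ _ _ p1 w01)).
have /andP[w0 w1] := w01.
by apply: lerD; apply: ler_wpM2l; rewrite ?subr_ge0//; exact: value_le_bell.
Qed.

Lemma bell_glue n x t L : t ^+ 2 <= L ->
  (bell n (x + t) (L - t ^+ 2) + bell n (x - t) (L - t ^+ 2)) / 2 <= bell n.+1 x L.
Proof.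
move=> tL; have L0 : 0 <= L - t ^+ 2 by rewrite subr_ge0.
have L1 : 0 <= L by apply: le_trans tL; exact: sqr_ge0.
rewrite ler_pdivrMr// -lerBrDr; apply: bell_le => // c1 h1.
rewrite lerBrDr -lerBrDl; apply: bell_le => // c2 h2.
rewrite lerBrDl -ler_pdivrMr//.
(* Play [t] first, then [c1] after outcome + and [c2] after outcome -. *)
pose c s := if s is b :: s' then (if b then c2 else c1) s' else t.
apply: (@value_le_bell n.+1 c x L) => //=.
by rewrite -lerBrDl ge_max h1 h2.
Qed.

(** The slope is that of the chord of the convex function [bell n _ (L - t ^+ 2)] from [x - t] to
    [x + t]; by [bell_glue] the height of the chord at [x] is at most [bell n.+1 x L]. *)
Lemma bell_step n x t L : 0 <= t -> t ^+ 2 <= L ->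
  exists b, forall d, `|d| <= t ->
    bell n (x + d) (L - t ^+ 2) <= bell n.+1 x L + b * d.
Proof.
move=> t0 tL; have := bell_glue n x tL.
have L0 : 0 <= L - t ^+ 2 by rewrite subr_ge0.
move: t0; rewrite le_eqVlt => /predU1P[<-|t_gt0] glue.
  (* For [t = 0] there is no chord, but [d = 0] and any slope works. *)
  exists 0 => d; rewrite normr_le0 => /eqP ->.
  by move: glue tL; rewrite addr0 subr0 mul0r; lra.
set u := bell n (x + t) _ in glue *; set v := bell n (x - t) _ in glue *.
exists ((u - v) / (2 * t)) => d dt.
(* The weight of [x + t] when [x + d] is a convex combination of [x + t] and [x - t]. *)
pose w := (t + d) / (2 * t).
have t2 : 2 * t != 0 by rewrite gt_eqF//; lra.
have w01 : 0 <= w <= 1.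
  have dt' := dt; rewrite ler_norml in dt'.
  by rewrite /w divr_ge0 ?ler_pdivrMr//; lra.
have := @bell_convex n w (x + t) (x - t) (L - t ^+ 2) L0 w01.
have -> : w * (x + t) + (1 - w) * (x - t) = x + d by rewrite /w; field; lra.
rewrite -/u -/v => /le_trans; apply.
have -> : w * u + (1 - w) * v = (u + v) / 2 + (u - v) / (2 * t) * d.
  by rewrite /w; field; lra.
by rewrite lerD2r.
Qed.

End strategies.

(** * Countable partitions and functions constant on their cells *)

Section countable_partitions.
Local Open Scope classical_set_scope.

(** Prepares for countable additivity: [F k] is the cell with code [k] under an injection into the
    naturals, and a code of no cell gives the empty set. *)
Lemma partition_enum (X : Type) (D : set (set X)) :
  countable D -> partition D id setT ->
  exists F : nat -> set X, [/\ forall k, F k = set0 \/ D (F k),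
    trivIset setT F & \bigcup_k F k = setT].
Proof.
move=> /countable_injP[g ginj] [covD tD _].
pose F k := \bigcup_(V in [set V | D V /\ g V = k]) V.
exists F; split.
- move=> k; have [[V [DV gV]]|noV] := pselect (exists V, D V /\ g V = k).
    right; suff -> : F k = V by [].
    apply/seteqP; split=> [x [W [DW gW] Wx]|x Vx]; last by exists V.
    have -> // : V = W by apply: ginj; rewrite ?inE// gW.
  left; rewrite -subset0 => x [V [DV gV] _]; apply: noV; by exists V.
- apply/trivIsetP => i j _ _ ij; rewrite -subset0 => x [[V [DV gV] Vx] [W [DW gW] Wx]].
  have VW : V = W by apply: tD => //; exists x.
  by move/eqP: ij; apply; rewrite -gV -gW VW.
- rewrite -subTset -covD => x [V DV Vx].
  by exists (g V) => //; exists V.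
Qed.

Lemma partition_ex (X : Type) (D : set (set X)) (x : X) :
  partition D id setT -> exists2 V, D V & V x.
Proof. by case=> covD _ _; have : cover D id x by rewrite covD. Qed.

Lemma partition_eq (X : Type) (D : set (set X)) (V W : set X) (x : X) :
  partition D id setT -> D V -> D W -> V x -> W x -> V = W.
Proof. by move=> [_ tD _] DV DW Vx Wx; apply: tD => //; exists x. Qed.

(** A pointwise substitute for measurability with respect to the sigma-algebra generated by a
    countable partition. *)
Definition constant_on_atoms (X Y : Type) (D : set (set X)) (f : X -> Y) :=
  forall V x y, D V -> V x -> V y -> f x = f y.

Lemma constant_on_atoms_measurable d (X : measurableType d) d' (Y : measurableType d')
    (D : set (set X)) (f : X -> Y) (A : set X) :
  countable D -> partition D id setT -> (forall V, D V -> measurable V) ->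
  measurable A -> constant_on_atoms D f -> measurable_fun A f.
Proof.
move=> cD pD mD mA fD _ B mB; apply: measurableI => //.
have [F [FD tF UF]] := partition_enum cD pD.
(* The preimage contains every cell that it meets, hence is a countable union of cells. *)
have -> : f @^-1` B = \bigcup_(k in [set k | F k `<=` f @^-1` B]) F k.
  apply/seteqP; split=> [x Bx|x [k Fk]]; last exact: Fk.
  have [k _ Fkx] : (\bigcup_k F k) x by rewrite UF.
  exists k => // y Fky.
  have DF : D (F k) by case: (FD k) => // F0; rewrite F0 in Fkx.
  by rewrite /preimage/= (fD _ _ _ DF Fky Fkx).
by apply: bigcup_measurable => k _; case: (FD k) => [->//|/mD].
Qed.

Lemma g_sigma_algebra_constant_on_atoms (R : realType) (X : pointedType) (D : set (set X))
    (f : X -> R) : partition D id setT ->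
  measurable_fun [set: g_sigma_algebraType D] (f : g_sigma_algebraType D -> R) ->
  constant_on_atoms D f.
Proof.
move=> pD mf V x y DV Vx Vy.
(* The sets that contain every cell they meet form a sigma-algebra; it contains [D], hence all that
   [D] generates. *)
pose C := [set A : set X | forall V x y, D V -> V x -> V y -> A x -> A y].
have DC : <<s D >> `<=` C.
  apply: smallest_sub; first split.
  - by move=> W a b _ _ _ [].
  - move=> A CA W a b DW Wa Wb [_ nAa]; split=> // Ab.
    by apply: nAa; exact: (CA _ _ _ DW Wb Wa Ab).
  - move=> A CA W a b DW Wa Wb [k _ Aka]; exists k => //.
    exact: (CA k _ _ _ DW Wa Wb Aka).
  move=> W DW V' a b DV' Va Vb Wa.
  by rewrite (partition_eq pD DW DV' Wa Va).
have := mf measurableT [set f x] (measurable_set1 _); rewrite setTI => mfx.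
have Cfx : C (f @^-1` [set f x]) by apply: DC; exact: mfx.
by rewrite (Cfx _ _ _ DV Vx Vy).
Qed.

(** Stands in for conditional expectation: the comparison of integrals on each cell is summed over
    the cells. *)
Lemma le_integral_partition (R : realType) d (X : measurableType d)
    (P : {measure set X -> \bar R}) (D : set (set X)) (f g : X -> \bar R) :
  countable D -> partition D id setT -> (forall V, D V -> measurable V) ->
  measurable_fun [set: X] f -> measurable_fun [set: X] g ->
  (forall x, 0 <= f x)%E -> (forall x, 0 <= g x)%E ->
  (forall V, D V -> \int[P]_(x in V) f x <= \int[P]_(x in V) g x)%E ->
  (\int[P]_x f x <= \int[P]_x g x)%E.
Proof.
move=> cD pD mD mf mg f0 g0 fg.
have [F [FD tF UF]] := partition_enum cD pD.
have mF k : measurable (F k) by case: (FD k) => [->//|/mD].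
rewrite -UF !ge0_integral_bigcup ?UF//.
apply: lee_nneseries => [k _ _|k _]; first exact: integral_ge0.
by case: (FD k) => [->|DFk]; [rewrite !integral_set0|exact: fg].
Qed.

End countable_partitions.

(** * Discrete filtrations and the local suprema [D_k] *)

Section filtrations.
Local Open Scope classical_set_scope.
Local Open Scope ereal_scope.
Context (R : realType) (d : measure_display) (X : measurableType d).
Variables (P : probability X R) (D : nat -> set (set X)).

Lemma Lnormy_probability (g : X -> \bar R) : 'N[P]_+oo[g] = ess_sup P (abse \o g).
Proof.
have PT : 0 < P setT by rewrite probability_setT.
by rewrite unlock /Lnorm PT.
Qed.

Lemma local_supE (f : nat -> X -> R) k V x :
  partition (D k.-1) id setT -> D k.-1 V -> V x ->
  local_sup P D f k x = 'N[P]_+oo[(fun y => (\1_V y * f k y)%:E)].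
Proof.
move=> pD DV Vx; rewrite /local_sup (esumID [set V]); last first.
  by move=> W _; rewrite mule_ge0 ?Lnorm_ge0 ?lee_fin.
rewrite [X in _ + X]esum1 ?adde0; last first.
  move=> W [DW WV]; rewrite indicE memNset ?mule0// => Wx.
  by apply: WV; rewrite /= (partition_eq pD DV DW Vx Wx).
have -> : D k.-1 `&` [set V] = [set V] by apply/seteqP; split=> [W []|W ->].
rewrite esum_set1; last by rewrite mule_ge0 ?Lnorm_ge0 ?lee_fin.
by rewrite indicE mem_set// mule1.
Qed.

Lemma local_sup_ge0 (f : nat -> X -> R) k x : 0 <= local_sup P D f k x.
Proof. by apply: esum_ge0 => V _; rewrite mule_ge0 ?Lnorm_ge0 ?lee_fin. Qed.

(** Each cell has its own exceptional null set; since the cells are countably many, their union is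
    still null. *)
Lemma ae_le_local_sup (f : nat -> X -> R) k : countable (D k.-1) ->
  partition (D k.-1) id setT ->
  \forall x \ae P, `|(f k x)%:E| <= local_sup P D f k x.
Proof.
move=> cD pD; have [F [FD tF UF]] := partition_enum cD pD.
have : \forall x \ae P, forall i,
    `|(\1_(F i) x * f k x)%:E| <= 'N[P]_+oo[(fun y => (\1_(F i) y * f k y)%:E)].
  apply/ae_foralln => i; rewrite Lnormy_probability.
  exact: (ess_sup_ge P (abse \o (fun y => (\1_(F i) y * f k y)%:E))).
apply: filterS => x Hx.
have [i _ Fix] : (\bigcup_k F k) x by rewrite UF.
have DF : D k.-1 (F i) by case: (FD i) => // F0; rewrite F0 in Fix.
rewrite (local_supE _ pD DF Fix); move: (Hx i).
by rewrite indicE mem_set// mul1r.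
Qed.

Hypothesis filD : discrete_filtration P D.

Lemma filtration_partition k : partition (D k) id setT.
Proof. by have [_ _ + _ _] := filD; apply. Qed.

Lemma filtration_countable k : countable (D k).
Proof. by have [_ + _ _ _] := filD; apply. Qed.

Lemma filtration_measurable k V : D k V -> measurable V.
Proof. by have [_ _ _ + _] := filD => /[apply] -[]. Qed.

(** Every cell of the finer partition lies inside a cell of the coarser one. *)
Lemma filtration_constant_on_atoms (Y : Type) (g : X -> Y) j k : (j <= k)%N ->
  constant_on_atoms (D j) g -> constant_on_atoms (D k) g.
Proof.
move=> /subnKC <-; elim: (k - j)%N => [|i IH]; first by rewrite addn0.
move=> /IH {}IH; rewrite addnS => W x y DW Wx Wy.
have [V DV Vx] := partition_ex x (filtration_partition (j + i)).
apply: (IH _ _ _ DV Vx).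
have [_ _ _ _ /(_ _ _ DV)[E ED VE]] := filD.
move: Vx; rewrite VE => -[W' EW' W'x]; exists W' => //.
by rewrite (partition_eq (filtration_partition _) (ED _ EW') DW W'x Wx).
Qed.

(** Cells have positive measure, so none fits into a null set. With constancy on cells this turns
    almost sure bounds into bounds at every point. *)
Lemma ae_atom (Q : set X) k V : D k V -> (\forall x \ae P, Q x) ->
  exists2 x, V x & Q x.
Proof.
move=> DV aeQ; apply: contrapT => noQ.
have [_ _ _ /(_ _ _ DV)[mV PV] _] := filD.
suff : P V = 0 by move=> PV0; rewrite PV0 ltxx in PV.
apply/negligibleP => //; apply: negligibleS aeQ => x Vx Qx.
by apply: noQ; exists x.
Qed.

Lemma local_sup_constant_on_atoms (f : nat -> X -> R) k :
  constant_on_atoms (D k.-1) (local_sup P D f k).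
Proof.
by move=> V x y DV Vx Vy; rewrite !(local_supE _ (filtration_partition _) DV).
Qed.

End filtrations.

(** * Upper bound for an arbitrary martingale difference *)

Section upper_bound.
Local Open Scope classical_set_scope.
Local Open Scope ereal_scope.
Context (R : realType) (d : measure_display) (X : measurableType d).
Variables (P : probability X R) (D : nat -> set (set X)).
Hypothesis filD : discrete_filtration P D.
Variables (n : nat) (f : nat -> X -> R) (s : R).
Hypothesis mdf : martingale_difference P D n f.
Hypothesis s0 : (0 <= s)%R.
Hypothesis Ss : 'N[P]_+oo[square_function P D n f] <= s%:E.

Let r k x : R := fine (local_sup P D f k x).

Lemma martingale_difference_constant_on_atoms k : (1 <= k <= n)%N ->
  constant_on_atoms (D k) (f k).
Proof.
move=> /mdf[_ mf _].
exact: (g_sigma_algebra_constant_on_atoms (filtration_partition filD k) mf).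
Qed.

Lemma sum_constant_on_atoms (V : nmodType) (g : nat -> X -> V) j k : (j <= k)%N ->
  (forall i, (1 <= i <= j)%N -> constant_on_atoms (D k) (g i)) ->
  constant_on_atoms (D k) (fun x => \sum_(1 <= i < j.+1) g i x)%R.
Proof.
move=> jk gc W x y DW Wx Wy.
by apply: eq_big_nat => i ij; apply: (gc i ij _ _ _ DW Wx Wy).
Qed.

(** Each [D_k] with [k <= n] is constant on the cells of [D n], and so is the square function; its
    almost sure bound [s] therefore holds everywhere. *)
Lemma sum_sqr_local_sup_le x :
  \sum_(1 <= k < n.+1) local_sup P D f k x ^+ 2 <= (s ^+ 2)%:E.
Proof.
have Sc : constant_on_atoms (D n)
    (fun x => \sum_(1 <= k < n.+1) local_sup P D f k x ^+ 2).
  move=> W a b DW Wa Wb; apply: eq_big_nat => i /andP[i1 iltn].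
  have in_n : (i.-1 <= n)%N by lia.
  have c := filtration_constant_on_atoms filD in_n
    (local_sup_constant_on_atoms filD f (k := i)).
  by rewrite (c _ _ _ DW Wa Wb).
have [W DW Wx] := partition_ex x (filtration_partition filD n).
have : \forall y \ae P, square_function P D n f y <= s%:E.
  move: Ss; rewrite Lnormy_probability => /ess_supP.
  by apply: filterS => y; apply: le_trans; rewrite lee_abs.
move=> /(ae_atom filD DW)[y Wy]; rewrite /square_function.
rewrite (Sc _ _ _ DW Wx Wy); set S := \sum_(_ <= _ < _) _ => Ssy.
have S0 : 0 <= S by apply: sume_ge0 => k _; exact: sqre_ge0.
have SI : S `^ 2^-1 \in `[0%E, +oo%E]%R by rewrite in_itv/= poweR_ge0 leey.
have sI : s%:E \in `[0%E, +oo%E]%R by rewrite in_itv/= lee_fin s0 leey.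
have := gt0_ler_poweR (ler0n R 2) SI sI Ssy.
by rewrite -poweRrM mulVf// poweRe1// poweR_EFin powR_mulrn.
Qed.

Lemma local_sup_fin k x : (1 <= k <= n)%N -> local_sup P D f k x = (r k x)%:E.
Proof.
move=> kn; rewrite /r fineK// ge0_fin_numE ?local_sup_ge0//.
rewrite ltey; apply/eqP => ky.
suff : local_sup P D f k x ^+ 2 <= (s ^+ 2)%:E by rewrite ky expe2 mulyy leye_eq.
apply: le_trans (sum_sqr_local_sup_le x).
rewrite (bigD1_seq k) ?iota_uniq ?mem_index_iota//.
by apply: leeDl; apply: sume_ge0 => i _; exact: sqre_ge0.
Qed.

Lemma sum_sqr_le x j : (j <= n)%N -> (\sum_(1 <= k < j.+1) r k x ^+ 2 <= s ^+ 2)%R.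
Proof.
move=> jn; rewrite -lee_fin; apply: le_trans (sum_sqr_local_sup_le x).
rewrite -sumEFin.
rewrite [leRHS](@big_cat_nat _ _ _ j.+1 1%N n.+1)//.
rewrite -[leLHS]adde0 leeD//; last by apply: sume_ge0 => i _; exact: sqre_ge0.
rewrite (@eq_big_nat _ _ _ _ _ _ (fun k => local_sup P D f k x ^+ 2))// => k /andP[k1 kj].
by rewrite local_sup_fin ?EFin_expe//; lia.
Qed.

(** Both sides are constant on the cells of [D k], so one good point per cell is enough. *)
Lemma normr_le_local_sup k x : (1 <= k <= n)%N -> (`|f k x| <= r k x)%R.
Proof.
move=> kn; have [W DW Wx] := partition_ex x (filtration_partition filD k).
have [y Wy] := ae_atom filD DW (ae_le_local_sup P f (filtration_countable filD k.-1)
  (filtration_partition filD k.-1)).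
have c := filtration_constant_on_atoms filD (leq_pred k)
  (local_sup_constant_on_atoms filD f (k := k)).
rewrite -(c _ _ _ DW Wx Wy) local_sup_fin// lee_fin.
by rewrite (martingale_difference_constant_on_atoms kn DW Wx Wy).
Qed.

(** One square is at most the sum of all. Applied later with [s = 0], where it says that a vanishing
    square function forces every difference to vanish everywhere. *)
Lemma normr_martingale_difference_le k x : (1 <= k <= n)%N -> (`|f k x| <= s)%R.
Proof.
move=> kn; apply: (le_trans (normr_le_local_sup x kn)).
rewrite -(ler_pXn2r (_ : 0 < 2)%N) ?nnegrE//; last by rewrite fine_ge0 ?local_sup_ge0.
apply: le_trans (sum_sqr_le x (leqnn n)).
rewrite (bigD1_seq k) ?iota_uniq ?mem_index_iota//=.
by rewrite lerDl sumr_ge0// => i _; exact: sqr_ge0.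
Qed.

Variable p : R.
Hypothesis p1 : (1 <= p)%R.

(** The Bellman value of what is left after [k] steps, from the position reached and with the
    unspent part of [s ^+ 2]. *)
Let potential k x : R := bell p (n - k) (\sum_(1 <= i < k.+1) f i x)%R
  (s ^+ 2 - \sum_(1 <= i < k.+1) r i x ^+ 2)%R.

Lemma potential_ge0 k x : (k <= n)%N -> (0 <= potential k x)%R.
Proof. by move=> kn; apply: bell_ge0; rewrite // subr_ge0 sum_sqr_le. Qed.

Lemma sum_martingale_constant_on_atoms k : (k <= n)%N ->
  constant_on_atoms (D k) (fun x => \sum_(1 <= i < k.+1) f i x)%R.
Proof.
move=> kn; apply: sum_constant_on_atoms => // i /andP[i1 ik].
apply: (filtration_constant_on_atoms filD ik).
by apply: martingale_difference_constant_on_atoms; lia.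
Qed.

Lemma sum_sqr_constant_on_atoms k :
  constant_on_atoms (D k) (fun x => \sum_(1 <= i < k.+1) r i x ^+ 2)%R.
Proof.
apply: (sum_constant_on_atoms (g := fun i x => r i x ^+ 2)%R) => // i /andP[i1 ik].
have ik' : (i.-1 <= k)%N by lia.
have c := filtration_constant_on_atoms filD ik' (local_sup_constant_on_atoms filD f (k := i)).
by move=> W a b DW Wa Wb; rewrite /r (c _ _ _ DW Wa Wb).
Qed.

Lemma potential_constant_on_atoms k : (k <= n)%N ->
  constant_on_atoms (D k) (potential k).
Proof.
move=> kn V x y DV Vx Vy; rewrite /potential.
by rewrite (sum_martingale_constant_on_atoms kn DV Vx Vy) (sum_sqr_constant_on_atoms DV Vx Vy).
Qed.

Lemma measurable_potential k (A : set X) : (k <= n)%N -> measurable A ->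
  measurable_fun A (fun x => (potential k x)%:E).
Proof.
move=> kn mA; apply: (constant_on_atoms_measurable (filtration_countable filD k)
  (filtration_partition filD k)) => //; first by move=> V /(filtration_measurable filD).
by move=> V x y DV Vx Vy; rewrite (potential_constant_on_atoms kn DV Vx Vy).
Qed.

(** A supermartingale inequality, checked on each cell of [D k]: there the position, the budget and
    [D_(k+1)] are constants, so one affine bound from [bell_step] serves the whole cell. *)
Lemma integral_potential_le k : (k < n)%N ->
  \int[P]_x (potential k.+1 x)%:E <= \int[P]_x (potential k x)%:E.
Proof.
move=> kn; have kn' := ltnW kn.
apply: (le_integral_partition (D := D k)) => //.
- exact: (filtration_countable filD).
- exact: (filtration_partition filD).
- by move=> V /(filtration_measurable filD).
- exact: measurable_potential.
- exact: measurable_potential.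
- by move=> x; rewrite lee_fin potential_ge0.
- by move=> x; rewrite lee_fin potential_ge0.
move=> V DV; have mV := filtration_measurable filD DV.
have [_ _ /(_ _ DV)[x Vx]] := filtration_partition filD k.
have k1 : (1 <= k.+1 <= n)%N by rewrite kn.
have t0 : (0 <= r k.+1 x)%R by apply: le_trans (normr_le_local_sup x k1).
pose L := (s ^+ 2 - \sum_(1 <= i < k.+1) r i x ^+ 2)%R.
have tL : (r k.+1 x ^+ 2 <= L)%R.
  by have := sum_sqr_le x kn; rewrite big_nat_recr//= lerBrDl.
have rc y : V y -> r k.+1 y = r k.+1 x.
  by move=> Vy; rewrite /r (local_sup_constant_on_atoms filD f (k := k.+1) DV Vy Vx).
have [b Hb] := bell_step p1 (n - k.+1) (\sum_(1 <= i < k.+1) f i x)%R t0 tL.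
have potx y : V y -> potential k y = potential k x.
  by move=> Vy; apply: (potential_constant_on_atoms kn' DV Vy Vx).
have [intf _ /(_ V DV) intf0] := mdf k1.
have intfV : P.-integrable V (EFin \o f k.+1) by apply: integrableS intf.
have step y : V y -> (potential k.+1 y <= potential k x + b * f k.+1 y)%R.
  move=> Vy.
  have fy := normr_le_local_sup y k1.
  have := Hb (f k.+1 y); rewrite -{1}(rc y Vy) => /(_ fy).
  rewrite -subSn// subSS -/(potential k x); congr (_ <= _)%R; rewrite /potential.
  rewrite !(big_nat_recr k.+1)//= opprD addrA rc//.
  rewrite (sum_martingale_constant_on_atoms kn' DV Vy Vx).
  by rewrite (sum_sqr_constant_on_atoms DV Vy Vx).
pose c := potential k x; pose g y := (b * f k.+1 y)%R.
have intc : P.-integrable V (EFin \o cst c) by exact: finite_measure_integrable_cst.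
have intg : P.-integrable V (EFin \o g).
  by apply: eq_integrable (integrableZl mV b intfV) => // y _; rewrite /= EFinM.
(* Since [f k.+1] has integral zero over [V], adding [b * f k.+1] keeps the integral and makes the
   comparison pointwise. *)
have -> : \int[P]_(y in V) (potential k y)%:E =
    \int[P]_(y in V) ((EFin \o cst c) \+ (EFin \o g)) y.
  rewrite integralD_EFin//.
  have -> : \int[P]_(y in V) (EFin \o g) y = 0.
    transitivity (\int[P]_(y in V) (b%:E * (EFin \o f k.+1) y)).
      by apply: eq_integral => y _; rewrite /= EFinM.
    by rewrite integralZl// intf0 mule0.
  by rewrite adde0; apply: eq_integral => y; rewrite inE => Vy; rewrite /= potx.
apply: ge0_le_integral => //.
- by move=> y _; rewrite lee_fin potential_ge0.
- exact: measurable_potential.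
- by apply: emeasurable_funD; [case/integrableP: intc|case/integrableP: intg].
Qed.

Lemma integral_martingale_le :
  \int[P]_x (`|\sum_(1 <= k < n.+1) f k x| `^ p)%:E <= (bell p n 0 (s ^+ 2))%:E.
Proof.
(* The induction goes back from time [n], where the potential is the [p]-th power, to time [0],
   where it is constant. *)
have H k : (k <= n)%N -> \int[P]_x (potential n x)%:E <= \int[P]_x (potential (n - k) x)%:E.
  elim: k => [|k IH kn]; first by rewrite subn0.
  apply: (le_trans (IH (ltnW kn))); have -> : (n - k = (n - k.+1).+1)%N by lia.
  by apply: integral_potential_le; lia.
have := H n (leqnn n); rewrite subnn.
have -> : \int[P]_x (potential 0 x)%:E = (bell p n 0 (s ^+ 2))%:E.
  under eq_integral do rewrite /potential !big_geq// subn0 subr0.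
  have PT : P setT = 1 by exact: probability_setT.
  by rewrite integral_cst// [X in _ * X]PT mule1.
apply: le_trans; rewrite le_eqVlt; apply/orP; left; apply/eqP.
by apply: eq_integral => x _; rewrite /potential subnn bell0// subr_ge0 sum_sqr_le.
Qed.

End upper_bound.

(** * Dyadic intervals of [[0, 1)] and their numbering *)

Section dyadic_atoms.
Local Open Scope classical_set_scope.
Context (R : realType).
Implicit Types (x : borel01 R) (k i : nat).

(** The number of the dyadic interval of generation [k] around [x], counted from 0, whereas
    [dyadic_partition] counts from 1. *)
Definition idx k x : nat := Num.truncn (2 ^+ k * Ico01_val x).

Definition atom k i : set (borel01 R) := [set x | idx k x = i].

Lemma Ico01_val_itv x : 0 <= Ico01_val x < 1.
Proof. exact: (svalP x). Qed.

Lemma idx_eq k i x : (idx k x == i) = (i%:R <= 2 ^+ k * Ico01_val x < i.+1%:R).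
Proof.
by rewrite truncn_eq// mulr_ge0 ?exprn_ge0//; case/andP: (Ico01_val_itv x).
Qed.

Lemma idx_itv k x : (idx k x)%:R <= 2 ^+ k * Ico01_val x < (idx k x).+1%:R.
Proof. by rewrite -idx_eq. Qed.

Lemma idx_lt k x : (idx k x < 2 ^ k)%N.
Proof.
have /andP[h _] := idx_itv k x.
rewrite -(ltr_nat R) natrX (le_lt_trans h)// gtr_pMr ?exprn_gt0//.
by case/andP: (Ico01_val_itv x).
Qed.

(** Passing to the parent interval drops the last binary digit, so the parity of [idx k.+1 x] tells
    the right half from the left. *)
Lemma idxS k x : (idx k.+1 x)./2 = idx k x.
Proof.
apply/esym/eqP; rewrite idx_eq.
have /andP[] := idx_itv k.+1 x; rewrite exprS -mulrA; set v := 2 ^+ k * _.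
set m := idx k.+1 x.
have := odd_double_half m; set h := m./2.
move=> <-; rewrite -natr1 -!natr1 natrD -muln2 natrM.
by case: (odd m) => /= h1 h2; apply/andP; split; lra.
Qed.

Lemma atomE k i : atom k i =
  [set x | (i.+1%:R - 1) / 2 ^+ k <= Ico01_val x < i.+1%:R / 2 ^+ k].
Proof.
apply/seteqP; split => x; rewrite /atom/=.
  by move=> /eqP; rewrite idx_eq -(natr1 i) addrK ler_pdivrMr ?exprn_gt0// ltr_pdivlMr ?exprn_gt0// mulrC.
move=> H; apply/eqP; rewrite idx_eq; move: H.
by rewrite -(natr1 i) addrK ler_pdivrMr ?exprn_gt0// ltr_pdivlMr ?exprn_gt0// mulrC.
Qed.

Lemma dyadic_partitionE k : dyadic_partition k = [set atom k i | i in [set i | (i < 2 ^ k)%N]].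
Proof.
apply/seteqP; split=> [V [[//|i] /andP[_ ik] ->]|_ [i /= ik <-]].
  by exists i => //; rewrite atomE.
by exists i.+1; rewrite ?ik// atomE.
Qed.

Lemma dyadic_partition_idx k x : dyadic_partition k (atom k (idx k x)).
Proof. by rewrite dyadic_partitionE; exists (idx k x) => //=; exact: idx_lt. Qed.

Lemma atom_itv k i : (i < 2 ^ k)%N ->
  @Ico01_val R @` atom k i = `[i%:R / 2 ^+ k, i.+1%:R / 2 ^+ k[.
Proof.
move=> ik; rewrite atomE -(natr1 i) addrK.
apply/seteqP; split=> [_ [x /= xi <-]|v]; first by rewrite /= in_itv.
rewrite /= in_itv/= => /andP[v0 v1].
have v01 : 0 <= v < 1.
  rewrite (le_trans _ v0) ?divr_ge0// (lt_le_trans v1)//.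
  by rewrite ler_pdivrMr ?exprn_gt0// mul1r natr1 -natrX ler_nat.
by exists (exist _ v v01) => //; apply/andP.
Qed.

Lemma measurable_atom k i : measurable (atom k i).
Proof.
rewrite atomE.
exists [set v : R | (i.+1%:R - 1) / 2 ^+ k <= v < i.+1%:R / 2 ^+ k]; last by rewrite setTI.
have -> : [set v : R | (i.+1%:R - 1) / 2 ^+ k <= v < i.+1%:R / 2 ^+ k] =
  `[(i.+1%:R - 1) / 2 ^+ k, i.+1%:R / 2 ^+ k[ by apply/seteqP; split=> v /=; rewrite in_itv.
exact: measurable_itv.
Qed.

Lemma lebesgue01_atom k i : (i < 2 ^ k)%N -> lebesgue01 (atom k i) = ((2 ^+ k)^-1)%:E.
Proof.
move=> ik; rewrite /lebesgue01 atom_itv// lebesgue_measure_itv/= lte_fin.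
rewrite ltr_pM2r ?invr_gt0 ?exprn_gt0// ltr_nat ltnSn -EFinD -mulrBl.
by rewrite -(natr1 i) [_ + 1]addrC addrK mul1r.
Qed.

Lemma atomS k i : atom k i = atom k.+1 i.*2 `|` atom k.+1 i.*2.+1.
Proof.
apply/seteqP; split => x; rewrite /atom/= -(idxS k x).
  by move=> <-; lia.
by case=> ->; lia.
Qed.

Lemma discrete_filtration_dyadic : discrete_filtration (@lebesgue01 R) (@dyadic_partition R).
Proof.
split.
- rewrite dyadic_partitionE; apply/seteqP; split=> [_ [i + <-]|_ ->].
    rewrite /= expn0 ltnS leqn0 => /eqP ->.
    by apply/seteqP; split=> x // _; have := idx_lt 0 x; rewrite expn0 ltnS leqn0 => /eqP.
  exists 0%N => //=; apply/seteqP; split=> x // _.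
  by have := idx_lt 0 x; rewrite expn0 ltnS leqn0 => /eqP.
- move=> k; rewrite dyadic_partitionE; apply: finite_set_countable.
  by apply: finite_image; exact: finite_II.
- move=> k; rewrite dyadic_partitionE; split.
  + rewrite -subTset => x _; exists (atom k (idx k x)) => //.
    by exists (idx k x) => //=; exact: idx_lt.
  + by move=> _ _ [i _ <-] [j _ <-] [x [<- <-]].
  + move=> _ [i /= ik <-].
    have : (0 < lebesgue01 (atom k i))%E by rewrite lebesgue01_atom// lte_fin invr_gt0 exprn_gt0.
    move=> P0; apply/set0P/negP => /eqP a0; move: P0.
    by rewrite a0 measure0 ltxx.
- move=> k V; rewrite dyadic_partitionE => -[i /= ik <-]; split; first exact: measurable_atom.
  by rewrite lebesgue01_atom// lte_fin invr_gt0 exprn_gt0.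
- move=> k V; rewrite !dyadic_partitionE => -[i /= ik <-].
  exists [set atom k.+1 i.*2; atom k.+1 i.*2.+1].
    by move=> _ [->|->]; [exists i.*2|exists i.*2.+1] => //=; rewrite expnS; lia.
  by rewrite bigcup_setU1 bigcup_set1 atomS.
Qed.

End dyadic_atoms.

(** * Haar martingales in terms of dyadic atoms *)

Section haar_martingales.
Local Open Scope classical_set_scope.
Context (R : realType).
Implicit Types (x : borel01 R) (k i : nat) (a : nat -> R).

Lemma integral_atom_constant (g : borel01 R -> \bar R) k i (r : R) : (i < 2 ^ k)%N ->
  (forall x, idx k x = i -> g x = r%:E) ->
  (\int[@lebesgue01 R]_(x in atom k i) g x = (r / 2 ^+ k)%:E)%E.
Proof.
move=> ik gr; rewrite (eq_integral (cst r%:E)); last first.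
  by move=> x; rewrite inE => /gr.
rewrite integral_cst; last exact: measurable_atom.
by rewrite EFinM; congr (_ * _)%E; exact: lebesgue01_atom.
Qed.

(** Here [j = i.+1] in the numbering [m = 2 ^ k + j], and the halves of interval [i] have the
    numbers [i.*2] and [i.*2.+1] one level down. *)
Lemma haarE k i x : (i < 2 ^ k)%N -> haar (2 ^ k + i).+1 (Ico01_val x) =
  (idx k.+1 x == i.*2)%:R - (idx k.+1 x == i.*2.+1)%:R.
Proof.
move=> ik; rewrite /haar/=.
have -> : trunc_log 2 (2 ^ k + i) = k.
  by apply: trunc_log_eq => //; rewrite leq_addr expnS; lia.
have -> : ((2 ^ k + i).+1 - 2 ^ k)%N = i.+1 by lia.
have q0 : 0 < 2 ^+ k :> R by rewrite exprn_gt0.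
have e1 : (i.+1%:R - 1) / 2 ^+ k = i.*2%:R / 2 ^+ k.+1 :> R.
  by rewrite exprS -muln2 natrM -(natr1 i); field; rewrite gt_eqF.
have e2 : (2 * i.+1%:R - 1) / 2 ^+ k.+1 = i.*2.+1%:R / 2 ^+ k.+1 :> R.
  by rewrite -(natr1 i.*2) -muln2 natrM -(natr1 i); congr (_ / _); ring.
have e3 : i.+1%:R / 2 ^+ k = i.*2.+2%:R / 2 ^+ k.+1 :> R.
  by rewrite exprS -doubleS -muln2 natrM; field; rewrite gt_eqF.
have H m (u v : R) : u = m%:R / 2 ^+ k.+1 -> v = m.+1%:R / 2 ^+ k.+1 ->
    \1_(`[u, v[) (Ico01_val x) = (idx k.+1 x == m)%:R :> R.
  move=> -> ->; rewrite indicE idx_eq mem_setE in_itv/=.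
  by rewrite ler_pdivrMr ?exprn_gt0// ltr_pdivlMr ?exprn_gt0// mulrC.
by rewrite (H _ _ _ e1 e2) (H _ _ _ e2 e3).
Qed.

(** Of the Haar functions of level [k] only the one supported on the interval of [x] is nonzero at
    [x]; its sign is + on the left half. *)
Lemma haar_martingaleE a k x : haar_martingale a k.+1 x =
  (-1) ^+ odd (idx k.+1 x) * a (2 ^ k + idx k x).+1.
Proof.
rewrite /haar_martingale/= big_add1/=.
rewrite (bigD1_seq (2 ^ k + idx k x)%N) ?iota_uniq//=; last first.
  by rewrite mem_index_iota leq_addr expnS; have := idx_lt k x; lia.
rewrite big_nat_cond big1 ?addr0; last first.
  move=> j /andP[/andP[j1 j2] /eqP ji].
  have [i [ij ik]] : exists i, (j = 2 ^ k + i)%N /\ (i < 2 ^ k)%N.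
    by exists (j - 2 ^ k)%N; move: j2; rewrite expnS; lia.
  rewrite ij haarE//.
  have /eqP := ji; rewrite ij -(idxS k) => {}ji.
  have -> : (idx k.+1 x == i.*2) = false by apply/negbTE/eqP; lia.
  have -> : (idx k.+1 x == i.*2.+1) = false by apply/negbTE/eqP; lia.
  by rewrite subrr mulr0.
rewrite haarE ?idx_lt// -(idxS k) mulrC.
have := odd_double_half (idx k.+1 x); set m := idx k.+1 x.
case: (odd m) => /= m2.
  have -> : (m == m./2.*2) = false by apply/negbTE/eqP; lia.
  have -> : (m == m./2.*2.+1) by apply/eqP; lia.
  by rewrite sub0r expr1.
have -> : (m == m./2.*2.+1) = false by apply/negbTE/eqP; lia.
have -> : (m == m./2.*2) by apply/eqP; lia.
by rewrite subr0 expr0.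
Qed.

Lemma haar_martingale_constant_on_atoms a k :
  constant_on_atoms (@dyadic_partition R k.+1) (haar_martingale a k.+1).
Proof.
move=> V x y; rewrite dyadic_partitionE => -[i _ <-].
rewrite /atom/= => xi yi.
by rewrite !haar_martingaleE -!(idxS k) xi yi.
Qed.

Lemma haar_martingale_bound a k x :
  `|haar_martingale a k.+1 x| <= \sum_(0 <= j < 2 ^ k) `|a (2 ^ k + j).+1|.
Proof.
rewrite haar_martingaleE normrM normrX normrN1 expr1n mul1r.
rewrite (bigD1_seq (idx k x)) ?iota_uniq ?mem_index_iota ?idx_lt//=.
by rewrite lerDl sumr_ge0.
Qed.

Lemma atom_disjoint k i : [disjoint @atom R k.+1 i.*2 & atom k.+1 i.*2.+1]%classic.
Proof.
rewrite disj_set2E; apply/eqP; rewrite -subset0 => x []; rewrite /atom/= => ->.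
by move=> /eqP; rewrite eqn_leq ltnn andbF.
Qed.

Lemma martingale_difference_haar a n :
  martingale_difference (@lebesgue01 R) (@dyadic_partition R) n (haar_martingale a).
Proof.
move=> [//|k] kn; have filD := discrete_filtration_dyadic R.
have mf (A : set (borel01 R)) : measurable A -> measurable_fun A (haar_martingale a k.+1).
  move=> mA; apply: (constant_on_atoms_measurable (filtration_countable filD k.+1)
    (filtration_partition filD k.+1)) => //.
    by move=> V /(filtration_measurable filD).
  exact: haar_martingale_constant_on_atoms.
split.
- apply: measurable_bounded_integrable => //.
  + by rewrite (le_lt_trans (probability_le1 _ _)) ?ltry.
  + exact: mf.
  exists (\sum_(0 <= j < 2 ^ k) `|a (2 ^ k + j).+1|); split; first exact: num_real.
  by move=> M /ltW SM x _; apply: le_trans SM; exact: haar_martingale_bound.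
- apply: (@constant_on_atoms_measurable _
      (g_sigma_algebraType (@dyadic_partition R k.+1)) _ _ (@dyadic_partition R k.+1)) => //.
  + exact: (filtration_countable filD k.+1).
  + exact: (filtration_partition filD k.+1).
  + by move=> V DV; apply: sub_sigma_algebra.
  + exact: haar_martingale_constant_on_atoms.
- move=> V /=; rewrite dyadic_partitionE => -[i /= ik <-].
  rewrite atomS integral_setU//=; first last.
  + exact: atom_disjoint.
  + by apply/measurable_EFinP; apply: mf; apply: measurableU; exact: measurable_atom.
  + exact: measurable_atom.
  + exact: measurable_atom.
  (* The bit [b] selects the half; the halves have equal length and opposite values, so their
     integrals cancel. *)
  have H (b : bool) : (\int[@lebesgue01 R]_(x in atom k.+1 (b + i.*2)) (haar_martingale a k.+1 x)%:E =
      ((-1) ^+ b * a (2 ^ k + i).+1 / 2 ^+ k.+1)%:E)%E.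
    apply: integral_atom_constant => [|x xb]; first by rewrite expnS; case: b; lia.
    rewrite haar_martingaleE -(idxS k) xb.
    by rewrite half_bit_double oddD odd_double addbF oddb.
  have := H false; have := H true; rewrite add0n add1n => -> ->.
  by rewrite -EFinD expr1 expr0 !mulN1r mul1r mulNr subrr.
Qed.

End haar_martingales.

(** * Realizing a strategy as a Haar martingale *)

Section haar_strategies.
Local Open Scope classical_set_scope.
Context (R : realType).
Variables (p : R) (c : seq bool -> R) (n : nat).
Implicit Types (x : borel01 R) (k i : nat).

(* The node at position i of level k, read off the binary digits of i. *)
Fixpoint node k i : seq bool :=
  if k is k'.+1 then rcons (node k' i./2) (odd i) else [::].

(** Inverts the numbering [m = 2 ^ k + i + 1] to find the node of interval [i] at level [k]. *)
Definition haar_coef (m : nat) : R :=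
  let k := trunc_log 2 m.-1 in c (node k (m.-1 - 2 ^ k)).

Definition subtree (s : seq bool) : seq bool -> R := fun u => c (s ++ u).

Lemma branch_subtree s b : branch (subtree s) b = subtree (rcons s b).
Proof. by apply/funext => u; rewrite /branch /subtree cat_rcons. Qed.

Local Notation f := (haar_martingale haar_coef).
Local Notation P := (@lebesgue01 R).
Local Notation D := (@dyadic_partition R).

Lemma haar_martingale_node k x :
  f k.+1 x = (-1) ^+ odd (idx k.+1 x) * c (node k (idx k x)).
Proof.
rewrite haar_martingaleE /haar_coef/=.
have -> : trunc_log 2 (2 ^ k + idx k x) = k.
  by apply: trunc_log_eq => //; rewrite leq_addr expnS; have := idx_lt k x; lia.
by rewrite addKn.
Qed.

Lemma local_sup_haar_le k x :
  (local_sup P D f k.+1 x <= `|c (node k (idx k x))|%:E)%E.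
Proof.
have filD := discrete_filtration_dyadic R.
rewrite (local_supE P f (k := k.+1) (filtration_partition filD k) (dyadic_partition_idx k x))//.
rewrite Lnormy_probability; apply/ess_supP; apply: nearW => y /=.
rewrite lee_fin indicE; have [yx|_] := boolP (y \in _); last by rewrite mul0r normr0.
rewrite mul1r haar_martingale_node normrM normrX normrN1 expr1n mul1r.
by move: yx; rewrite inE /atom/= => ->.
Qed.

(** Induction on the [m] steps left: [cost] takes the larger of two branches, while [x] follows one
    of them. *)
Lemma sum_sqr_local_sup_haar_le m k x : (m + k = n)%N ->
  (\sum_(k.+1 <= j < n.+1) local_sup P D f j x ^+ 2
   <= (cost m (subtree (node k (idx k x))))%:E)%E.
Proof.
elim: m k => [|m IH] k mk /=; first by rewrite big_geq//; lia.
rewrite big_ltn; last by lia.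
have /IH {}IH : (m + k.+1 = n)%N by lia.
rewrite EFinD; apply: leeD.
  rewrite /subtree cats0 -real_normK ?num_real// EFin_expe.
  have l0 := local_sup_ge0 P D f k.+1 x.
  by rewrite !expe2; apply: lee_pmul => //; exact: local_sup_haar_le.
apply: (le_trans IH); rewrite lee_fin !branch_subtree le_max /= idxS.
by case: odd; rewrite lexx ?orbT.
Qed.

Lemma Lnorm_square_function_haar_le s : 0 <= s -> cost n c <= s ^+ 2 ->
  ('N[P]_+oo[square_function P D n f] <= s%:E)%E.
Proof.
move=> s0 cs; rewrite Lnormy_probability; apply/ess_supP; apply: nearW => x /=.
rewrite gee0_abs ?poweR_ge0// /square_function; set S := (\sum_(_ <= _ < _) _)%E.
have Ss : (S <= (s ^+ 2)%:E)%E.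
  apply: (le_trans (@sum_sqr_local_sup_haar_le n 0 x (addn0 n))).
  by rewrite lee_fin.
have S0 : (0 <= S)%E by apply: sume_ge0 => i _; exact: sqre_ge0.
have SI : S \in `[0%E, +oo%E]%R by rewrite in_itv/= S0 leey.
have sI : (s ^+ 2)%:E \in `[0%E, +oo%E]%R by rewrite in_itv/= lee_fin sqr_ge0 leey.
have h0 : (0 : R) <= 2^-1 by rewrite invr_ge0.
apply: le_trans (gt0_ler_poweR h0 SI sI Ss) _.
by rewrite poweR_EFin -powR_mulrn// -powRrM mulfV// powRr1.
Qed.

Lemma measurable_haar_sum k (A : set (borel01 R)) (y : R) : measurable A ->
  measurable_fun A (fun x => (`|y + \sum_(k.+1 <= j < n.+1) f j x| `^ p)%:E).
Proof.
have filD := discrete_filtration_dyadic R.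
move=> mA; apply: (constant_on_atoms_measurable (filtration_countable filD n)
    (filtration_partition filD n)) => //.
  by move=> V /(filtration_measurable filD).
move=> V a b DV Va Vb; congr ((`|_ + _| `^ _)%:E).
apply: eq_big_nat => -[//|j] /andP[_ jn].
exact: (filtration_constant_on_atoms filD (jn : (j.+1 <= n)%N)
  (@haar_martingale_constant_on_atoms _ haar_coef j) DV Va Vb).
Qed.

(** The free [y] absorbs the earlier steps, so that the induction follows the recursion of [value]:
    halving an interval is one fair step, and [2 ^+ k] accounts for the length of the interval. *)
Lemma integral_haar m k i (y : R) : (m + k = n)%N -> (i < 2 ^ k)%N ->
  (\int[P]_(x in atom k i) (`|y + \sum_(k.+1 <= j < n.+1) f j x| `^ p)%:E
   = (value p m (subtree (node k i)) y / 2 ^+ k)%:E)%E.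
Proof.
elim: m k i y => [|m IH] k i y mk ik /=.
  by apply: integral_atom_constant => // x xi; rewrite big_geq ?addr0//; lia.
rewrite atomS ge0_integral_setU//=; first last.
- exact: atom_disjoint.
- by apply: measurable_haar_sum; apply: measurableU; exact: measurable_atom.
- exact: measurable_atom.
- exact: measurable_atom.
have H (b : bool) : (\int[P]_(x in atom k.+1 (b + i.*2))
     (`|y + \sum_(k.+1 <= j < n.+1) f j x| `^ p)%:E
   = (value p m (branch (subtree (node k i)) b)
       (y + (-1) ^+ b * c (node k i)) / 2 ^+ k.+1)%:E)%E.
  have bi : (b + i.*2)./2 = i by exact: half_bit_double.
  have ob : odd (b + i.*2) = b by rewrite oddD odd_double addbF oddb.
  have -> : branch (subtree (node k i)) b = subtree (node k.+1 (b + i.*2)).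
    by rewrite branch_subtree /= bi ob.
  rewrite -IH; [|by lia|by rewrite expnS; case: b {bi ob}; lia].
  apply: eq_integral => x; rewrite inE /atom/= => xb; rewrite big_ltn; last by lia.
  by rewrite haar_martingale_node xb ob -(idxS k) xb bi addrA.
have := H false; have := H true; rewrite add0n add1n => -> ->.
rewrite -EFinD expr1 expr0 mulN1r mul1r /subtree cats0 exprS; congr (_%:E).
by field; rewrite expf_neq0.
Qed.

Lemma integral_haar_value :
  (\int[P]_x (`|\sum_(1 <= j < n.+1) f j x| `^ p)%:E = (value p n c 0)%:E)%E.
Proof.
have := @integral_haar n 0 0 0 (addn0 n) isT; rewrite expr0 divr1 => <-.
have -> : @atom R 0 0 = setT.
  by apply/seteqP; split=> x // _; have := idx_lt 0 x; rewrite expn0 ltnS leqn0 => /eqP.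
by under [RHS]eq_integral do rewrite add0r.
Qed.

End haar_strategies.

(** * Comparison of the two constants *)

Section haar_extremal.
Local Open Scope classical_set_scope.
Local Open Scope ereal_scope.
Context (R : realType).
Variables (p : R) (n : nat).
Hypothesis p1 : (1 <= p)%R.

Lemma Lnorm_EFinE d (X : measurableType d) (P : probability X R) (g : X -> R) :
  'N[P]_p%:E[(fun x => (g x)%:E)] = (\int[P]_x (`|g x| `^ p)%:E) `^ p^-1.
Proof. by rewrite unlock. Qed.

Lemma norm_ratio_ge0 d (X : measurableType d) (P : probability X R) D f :
  0 <= norm_ratio P p D n f.
Proof. by rewrite /norm_ratio mule_ge0 ?inve_ge0 ?Lnorm_ge0. Qed.

(** The supremum of the empty set is [-oo], so an admissible Haar martingale has to be exhibited;
    all coefficients 1 will do. *)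
Lemma A_const_haar_ge0 : (1 <= n)%N -> 0 <= A_const_haar p n.
Proof.
move=> n1; pose c : seq bool -> R := fun=> 1%R.
apply: le_trans (norm_ratio_ge0 (@lebesgue01 R) (@dyadic_partition R)
  (haar_martingale (haar_coef c))) _.
apply: ereal_sup_ubound; exists (haar_coef c); split=> //.
have S1 := @Lnorm_square_function_haar_le R c n (Num.sqrt (cost n c)) (sqrtr_ge0 _).
rewrite /nontrivial_square_function (le_lt_trans (S1 _)) ?ltry ?sqr_sqrtr ?cost_ge0//.
rewrite andbT lt_neqAle Lnorm_ge0 andbT; apply/negP => /eqP N0.
(* A square function of norm zero would force the first difference to vanish, but its absolute value
   is 1. *)
have := normr_martingale_difference_le (discrete_filtration_dyadic R)
  (@martingale_difference_haar R (haar_coef c) n) (lexx 0%R) _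
  point (n1 : (1 <= 1 <= n)%N).
rewrite -N0 => /(_ (lexx _)); rewrite haar_martingale_node mulr1 normrX normrN1 expr1n.
by rewrite ler10.
Qed.

(** The Haar martingale built from [c] has a square function of norm at most [s], and
    [value p n c 0] is the [p]-th moment of its sum. *)
Lemma value_le_A_const_haar c (s : R) : (1 <= n)%N -> (0 < s)%R ->
  (cost n c <= s ^+ 2)%R ->
  (value p n c 0 `^ p^-1)%:E <= A_const_haar p n * s%:E.
Proof.
move=> n1 s0 cs; have A0 := A_const_haar_ge0 n1.
pose f := haar_martingale (haar_coef c).
have NS := Lnorm_square_function_haar_le (ltW s0) cs.
have : 0 <= 'N[@lebesgue01 R]_+oo[square_function (@lebesgue01 R) (@dyadic_partition R) n f].
  exact: Lnorm_ge0.
rewrite le_eqVlt => /predU1P[/esym N0|N0].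
  (* A zero square function is barred from the supremum, but then all differences vanish and so does
     the value. *)
  suff -> : value p n c 0 = 0%R by rewrite powR0 ?mule_ge0 ?lee_fin ?(ltW s0)// gt_eqF// invr_gt0 (lt_le_trans _ p1).
  apply/EFin_inj; rewrite -integral_haar_value.
  apply: integral0_eq => x _; rewrite big_nat big1 ?normr0 ?powR0//.
    by rewrite gt_eqF// (lt_le_trans _ p1).
  move=> k kn; apply/eqP; rewrite -normr_le0.
  apply: (normr_martingale_difference_le (discrete_filtration_dyadic R)
    (@martingale_difference_haar R (haar_coef c) n) (lexx 0%R)) => //.
  by rewrite N0.
have ubA : norm_ratio (@lebesgue01 R) p (@dyadic_partition R) n f <= A_const_haar p n.
  apply: ereal_sup_ubound; exists (haar_coef c); split=> //.
  by rewrite /nontrivial_square_function N0 (le_lt_trans NS) ?ltry.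
move: ubA; rewrite /norm_ratio Lnorm_EFinE integral_haar_value poweR_EFin.
move: N0 NS; case: ('N[_]_+oo[_]) => [t||]//; rewrite lte_fin lee_fin => t0 ts.
rewrite inver gt_eqF// lee_pdivrMr// => /le_trans; apply.
by apply: lee_wpmul2l; rewrite ?lee_fin.
Qed.

Lemma norm_ratio_le_A_const_haar d (X : measurableType d) (P : probability X R) D f :
  (1 <= n)%N -> discrete_filtration P D -> martingale_difference P D n f ->
  nontrivial_square_function P D n f -> norm_ratio P p D n f <= A_const_haar p n.
Proof.
move=> n1 filD mdf; rewrite /nontrivial_square_function /norm_ratio.
have bound s s0 Ss := @integral_martingale_le _ _ _ _ _ filD _ _ s mdf s0 Ss _ p1.
move: bound.
case: ('N[P]_+oo[_]) => [s||]; rewrite ?ltxx ?andbF// => bound /andP[s0 _].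
rewrite lte_fin in s0; have /(_ s (ltW s0) (lexx _)) {}bound := bound.
rewrite inver gt_eqF// lee_pdivrMr//.
have p0 : (0 < p)%R by rewrite (lt_le_trans _ p1).
have := fun c => @value_le_A_const_haar c s n1 s0; have := A_const_haar_ge0 n1.
(* Nonnegativity excludes [-oo], and for [+oo] the bound is trivial as [s] is positive. *)
case: (A_const_haar p n) => [a||]//; last by rewrite gt0_mulye ?lte_fin ?leey.
rewrite lee_fin => a0 H; have as0 : (0 <= a * s)%R by rewrite mulr_ge0// ltW.
have bas : (bell p n 0 (s ^+ 2) <= (a * s) `^ p)%R.
  apply: bell_le => [|c cs]; first exact: sqr_ge0.
  have := H c cs; rewrite -EFinM lee_fin => vas.
  have := ge0_ler_powR (ltW p0) _ _ vas; rewrite !nnegrE powR_ge0 as0 => /(_ isT isT).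
  by rewrite -powRrM mulVf ?gt_eqF// powRr1 ?value_ge0.
(* [a * s] is written as the [p]-th root of its [p]-th power, to compare before taking roots. *)
rewrite Lnorm_EFinE -EFinM -[(a * s)%R]powRr1// -(@mulfV _ p) ?gt_eqF// powRrM -poweR_EFin.
apply: (gt0_ler_poweR (r := p^-1)); rewrite ?invr_ge0 ?(ltW p0)//.
- by rewrite in_itv/= leey andbT integral_ge0// => x _; rewrite lee_fin powR_ge0.
- by rewrite in_itv/= lee_fin powR_ge0 leey.
- by apply: le_trans bound _; rewrite lee_fin.
Qed.

End haar_extremal.

Theorem theorem1p1 (R : realType) (p : R) (n : nat) :
  2 < p -> (1 <= n)%N -> A_const p n = A_const_haar p n.
Proof.
move=> p2 n1; have p1 : 1 <= p by lra.
apply/eqP; rewrite eq_le; apply/andP; split.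
  apply: ge_ereal_sup => _ [d [X [P [D [f [filD mdf ntf ->]]]]]].
  exact: norm_ratio_le_A_const_haar.
(* Conversely, Haar martingales compete in the general supremum. *)
apply: ge_ereal_sup => _ [a [nta ->]]; apply: ereal_sup_ubound.
do 5 eexists; split; [exact: discrete_filtration_dyadic|exact: martingale_difference_haar|exact: nta|by []].
Qed.
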